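(* Let $\mathcal{H}$ be a real Hilbert space, $C\subseteq\mathcal{H}$ nonempty, closed and convex, and $F:\mathcal{H}\to\mathcal{H}$ a mapping such that: (1) the solution set $SOL(C,F)=\{x^*\in C : \langle F(x^* ),x-x^*\rangle\ge 0 \text{ for all } x\in C\}$ is nonempty; (2) $F$ is monotone on $\mathcal{H}$: $\langle F(x)-F(y),x-y\rangle\ge 0$ for all $x,y\in\mathcal{H}$; (3) $F$ is Lipschitz continuous on $\mathcal{H}$ with constant $L>0$: $\|F(x)-F(y)\|\le L\|x-y\|$ for all $x,y\in\mathcal{H}$. Then the sequence $\{x^k\}_{k=0}^\infty$ generated by the subgradient extragradient method with outer perturbations (described in the context, with summable perturbations) converges weakly to a solution of the variational inequality, i.e. to a point of $SOL(C,F)$.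
   Context: $P_D$ denotes the metric projection of $\mathcal{H}$ onto a nonempty closed convex set $D$. Subgradient extragradient method with outer perturbations. Fix $\sigma>0$, $\rho\in(0,1)$, $\mu\in(0,1)$, and perturbation vectors $e_1^k=e_1(x^k)\in\mathcal{H}$, $e_2^k=e_2(x^k)\in\mathcal{H}$ ($k\ge 0$) with $\sum_{k=0}^\infty\|e_i^k\|<+\infty$ for $i=1,2$. Choose $x^0\in\mathcal{H}$. Given $x^k$, compute $$y^k=P_C\big(x^k-\gamma_kF(x^k)+e_1^k\big),$$ where $\gamma_k=\sigma\rho^{m_k}$ and $m_k$ is the smallest nonnegative integer such that (with $y^k$ computed using this $\gamma_k$) $$\gamma_k\|F(x^k)-F(y^k)\|\le\mu\|x^k-y^k\|.$$ Set $$T_k=\{w\in\mathcal{H} : \langle (x^k-\gamma_kF(x^k)+e_1^k)-y^k,\,w-y^k\rangle\le 0\},\qquad x^{k+1}=P_{T_k}\big(x^k-\gamma_kF(y^k)+e_2^k\big).$$ The method stops if $x^k=y^k$ and otherwise continues with $k+1$; the statement concerns an infinite generated sequence. *)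

(* Defs.v *)
(* The ambient real Hilbert space is a complete normed module H over a realType R
   with an inner product dot : {dot H for idfun} (a positive definite symmetric
   bilinear form) that induces the norm: norm_of_dot dot. *)
From HB Require Import structures.
From mathcomp Require Export all_boot all_order all_algebra.
From mathcomp Require Export all_classical all_reals all_analysis.
Export Order.TTheory GRing.Theory Num.Theory.
Export numFieldNormedType.Exports.

Set Implicit Arguments.
Unset Strict Implicit.
Unset Printing Implicit Defensive.

Local Open Scope classical_set_scope.
Local Open Scope ring_scope.

Section Defs.
Context {R : realType} {H : completeNormedModType R}.
Implicit Types (dot : {dot H for idfun}) (C D : set H) (F : H -> H).

Definition norm_of_dot dot : Prop := forall u : H, `|u| ^+ 2 = dot u u.

Definition is_nearest D (u p : H) : Prop :=
  D p /\ forall z, D z -> `|u - p| <= `|u - z|.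

(* Total: the junk value is u when u has no nearest point in D, which cannot
   happen for D nonempty, closed and convex; the nearest point is then unique. *)
Definition metric_proj D (u : H) : H := xget u [set p | is_nearest D u p].

Definition SOL dot C F : set H :=
  [set u | C u /\ forall v, C v -> 0 <= dot (F u) (v - u)].

Definition monotone_op dot F : Prop :=
  forall u v : H, 0 <= dot (F u - F v) (u - v).

Definition lipschitz_const (L : R) F : Prop :=
  forall u v : H, `|F u - F v| <= L * `|u - v|.

Definition weakly_cvg dot (x : nat -> H) (u : H) : Prop :=
  forall v : H, dot (x n) v @[n --> \oo] --> dot u v.

Definition proj_step C F (gamma : R) (e u : H) : H :=
  metric_proj C (u - gamma *: F u + e).

Definition linesearch_ok C F (mu gamma : R) (e u : H) : Prop :=
  let v := proj_step C F gamma e u in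
  gamma * `|F u - F v| <= mu * `|u - v|.

Definition halfspaceT dot (a v : H) : set H := [set w | dot (a - v) (w - v) <= 0].

(* x, y are the iterates and m k is the line-search exponent at step k; the
   perturbations are e_i^k = e_i k (x k).  The clause x k <> y k says that the
   stopping test never succeeds. *)
Definition perturbed_subgradient_extragradient dot C F (sigma rho mu : R)
    (e1 e2 : nat -> H -> H) (x y : nat -> H) (m : nat -> nat) : Prop :=
  forall k : nat,
  let gamma j := sigma * rho ^+ j in
  let gk := gamma (m k) in
  let e1k := e1 k (x k) in
  let e2k := e2 k (x k) in
  let Tk := halfspaceT dot (x k - gk *: F (x k) + e1k) (y k) in
  [/\ linesearch_ok C F mu gk e1k (x k),
      forall j, (j < m k)%N -> ~ linesearch_ok C F mu (gamma j) e1k (x k),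
      y k = proj_step C F gk e1k (x k),
      x k <> y k &
      x k.+1 = metric_proj Tk (x k - gk *: F (y k) + e2k)].

End Defs.

(* Main.v *)
(* For a solution s, the projection inequalities for y^k and x^(k+1) combine to
     |x^(k+1) - s|^2 <= |x^k - s|^2
       - (1 - mu) (|x^k - y^k|^2 + |x^(k+1) - y^k|^2)
       + 2 |e1| |x^(k+1) - y^k| + 2 |e2| |x^(k+1) - s|.
   Completing squares turns this into |x^(k+1) - s| <= |x^k - s| + summable, so
   |x^k - s| converges, and feeding this back gives |x^k - y^k| -> 0.  The line
   search keeps gamma_k above min(sigma, rho mu / L), so by Minty's lemma all
   weak limits of x along ultrafilters are solutions, and by Opial's argument
   they all coincide.  Ultrafilters replace weakly convergent subsequences, so
   no separability or diagonal argument is needed: the limit functional along an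
   ultrafilter is represented by Riesz's theorem. *)
Require Import Defs.
From mathcomp Require Import ring lra.

Set Implicit Arguments.
Unset Strict Implicit.
Unset Printing Implicit Defensive.

Local Open Scope classical_set_scope.
Local Open Scope ring_scope.

(** * Scalar convergence criteria and elementary inequalities *)

Section RealLimits.
Context {R : realType}.

(** Extracts first-order inequalities from comparisons at [u + t *: (v - u)]: after division by t,
    the quadratic remainder is of order t and vanishes in the limit. *)
Lemma le0_of_le_scale (a b : R) :
  (forall t, 0 < t -> t <= 1 -> a <= t * b) -> a <= 0.
Proof.
move=> h; rewrite leNgt; apply/negP => a0.
have b0 : 0 < b by apply: lt_le_trans a0 _; rewrite -[leRHS]mul1r h.
(* This t lies in (0, 1), and a <= t b would give a + b <= b. *)
have := h (a / (a + b)); rewrite divr_gt0 ?addr_gt0// => /(_ isT).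
rewrite ler_pdivrMr ?addr_gt0// mul1r lerDl ltW// => /(_ isT).
by rewrite mulrAC ler_pdivlMr ?addr_gt0// ler_pM2l// leNgt ltrDr a0.
Qed.

Lemma cvg_of_le_add_summable (d s : nat -> R) :
  (forall n, 0 <= d n) -> cvgn (series s) ->
  (forall n, d n.+1 <= d n + s n) -> cvgn d.
Proof.
move=> d0 cs dS.
(* d n - \sum_(k < n) s k is nonincreasing and bounded below. *)
have -> : d = (d - series s) + series s by rewrite subrK.
apply: is_cvgD => //; apply: nonincreasing_is_cvgn.
  apply/nonincreasing_seqP => n; rewrite !fctE /series/= big_nat_recr//=.
  by have := dS n; lra.
have [M [_ /(_ (M + 1))]] := cvg_seq_bounded cs.
rewrite ltrDl ltr01 => /(_ isT) Mb; exists (- (M + 1)) => _ [n _ <-].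
rewrite !fctE; have /= := Mb n I; have := d0 n; have := ler_norm (series s n).
by lra.
Qed.

Lemma cvg_of_dist_le (T : Type) (G : set_system T) {FG : Filter G}
    (f g : T -> R) l :
  (\near G, `|f G - l| <= g G) -> g t @[t --> G] --> 0 -> f t @[t --> G] --> l.
Proof.
move=> fg g0; have -> : f = (fun t => (f t - l) + l).
  by apply/funext => t; rewrite subrK.
rewrite -[X in _ --> X](add0r l); apply: cvgD; last exact: cvg_cst.
apply/norm_cvg0P/(squeeze_cvgr _ (cvg_cst 0) g0); near=> t.
by rewrite normr_ge0/=; near: t.
Unshelve. all: by end_near. Qed.

(** Compactness of [-M, M] gives a cluster point, and an ultrafilter converges to each of its
    cluster points. *)
Lemma ultrafilter_cvg_bounded (T : Type) (U : set_system T) (f : T -> R)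
    (M : R) :
  UltraFilter U -> (forall t, `|f t| <= M) -> cvg (f t @[t --> U]).
Proof.
move=> UU fM.
have [|l [_ lcl]] := @segment_compact _ (- M) M (fmap f U) _.
  by apply: nearW => t /=; rewrite in_itv/= -ler_norml.
apply/cvg_ex; exists l => A Al.
have [//|UA] := in_ultra_setVsetC (f @^-1` A) UU.
by have [r [Ar]] := lcl (~` A) A UA Al.
Qed.

(** If the preimage of a neighbourhood A of l is not in G, then G together with the complement of
    that preimage generates a proper filter; an ultrafilter above it contradicts the assumption. *)
Lemma cvg_ultrafilterP (T : Type) (G : set_system T) (f : T -> R)
    (l : R) : Filter G ->
  (forall U, UltraFilter U -> G `<=` U -> f t @[t --> U] --> l) ->
  f t @[t --> G] --> l.
Proof.
move=> FG h A Al; apply: contrapT => nA.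
have nGA : ~ G (f @^-1` A) by [].
have PG : ProperFilter (within (~` (f @^-1` A)) G).
  apply: Build_ProperFilter_ex => B GB; apply: contrapT => nB; apply: nGA.
  apply: (@filterS _ G FG _ _ _ GB) => t /= Bt; apply: contrapT => nAt.
  apply: nB; exists t.
  exact: Bt.
have [U [UU GU]] := ultraFilterLemma PG.
have UA : U (f @^-1` A).
  by apply: h Al => // B GB; apply: GU; move: GB; apply: filterS => t Bt _.
have UnA : U (~` (f @^-1` A)) by apply: GU; exact: nearW.
by have [t []] := filter_ex (filterI UA UnA).
Qed.

(** Completing the square in r: 2 a r - (1 - mu) r^2 is at most a^2 / (1 - mu). *)
Lemma quasi_fejer_bound (mu p r d d' a b : R) : mu < 1 ->
  d' ^+ 2 <= d ^+ 2 - (1 - mu) * (p ^+ 2 + r ^+ 2) + 2 * a * r + 2 * b * d' ->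
  (1 - mu) * p ^+ 2 <=
    d ^+ 2 - d' ^+ 2 + (1 - mu)^-1 * a ^+ 2 + 2 * b * d'.
Proof.
move=> mu1 h.
have k0 : 0 < 1 - mu by rewrite subr_gt0.
have : 0 <= (1 - mu)^-1 * ((1 - mu) * r - a) ^+ 2.
  by rewrite mulr_ge0 ?sqr_ge0// invr_ge0 ltW.
have -> : (1 - mu)^-1 * ((1 - mu) * r - a) ^+ 2 =
    (1 - mu) * r ^+ 2 - 2 * a * r + (1 - mu)^-1 * a ^+ 2.
  by field; rewrite gt_eqF.
by lra.
Qed.

(* Completing the square: (d' - b)^2 <= (d + k a + b)^2 since k >= 1. *)
Lemma le_add_of_sq_le (k d d' a b : R) : 1 <= k -> 0 <= a -> 0 <= b ->
  0 <= d -> d' ^+ 2 <= d ^+ 2 + k * a ^+ 2 + 2 * b * d' ->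
  d' <= d + (k * a + 2 * b).
Proof.
move=> k1 a0 b0 d0 h.
suff : d' - b <= d + k * a + b by lra.
have ka : 0 <= k * a by rewrite mulr_ge0// (le_trans _ k1).
have [/ltW d'b|d'b] := ltP (d' - b) 0.
  by apply: le_trans d'b _; rewrite !addr_ge0.
rewrite -ler_sqr ?nnegrE//; last by rewrite !addr_ge0.
have h1 : k * a ^+ 2 <= (k * a) ^+ 2.
  by rewrite exprMn ler_wpM2r ?sqr_ge0// ler_eXnr.
have := mulr_ge0 d0 ka; have := mulr_ge0 d0 b0; have := mulr_ge0 ka b0.
by lra.
Qed.

End RealLimits.

(** * Inner product calculus *)

Section RealHilbert.
Context {R : realType} {H : completeNormedModType R}.
Context (dot : {dot H for idfun}) (hdot : norm_of_dot dot).
Implicit Types (u v w z : H) (D : set H).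

Lemma dotC u v : dot u v = dot v u.
Proof. by rewrite hermC expr0 mul1r. Qed.

Lemma dotDl u v w : dot (u + v) w = dot u w + dot v w.
Proof. exact: linearDl. Qed.

Lemma dotNl u v : dot (- u) v = - dot u v.
Proof. exact: linearNl. Qed.

Lemma dotZl t u v : dot (t *: u) v = t * dot u v.
Proof. exact: linearZl_LR. Qed.

Lemma dotDr u v w : dot u (v + w) = dot u v + dot u w.
Proof. exact: linearDr. Qed.

Lemma dotNr u v : dot u (- v) = - dot u v.
Proof. exact: linearNr. Qed.

Lemma dotZr t u v : dot u (t *: v) = t * dot u v.
Proof. exact: linearZr_LR. Qed.

Definition dotE := (dotDl, dotNl, dotZl, dotDr, dotNr, dotZr).

Lemma dot_le u v : dot u v <= `|u| * `|v|.
Proof.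
have : `|u + v| ^+ 2 <= (`|u| + `|v|) ^+ 2.
  by rewrite ler_sqr ?nnegrE ?addr_ge0 ?ler_normD.
rewrite sqrrD !hdot !dotE (dotC v u); lra.
Qed.

Lemma dot_norm_le u v : `|dot u v| <= `|u| * `|v|.
Proof.
rewrite ler_norml dot_le andbT lerNl -dotNl.
by rewrite (le_trans (dot_le _ _))// normrN.
Qed.

Lemma dot_cvg (T : Type) (G : set_system T) {FG : Filter G} (f : T -> H) u v :
  f t @[t --> G] --> u -> dot (f t) v @[t --> G] --> dot u v.
Proof.
move=> fu; apply: (@cvg_of_dist_le _ _ _ _ _ (fun t => `|f t - u| * `|v|)).
  by apply: nearW => t; rewrite -dotNl -dotDl dot_norm_le.
rewrite -[X in _ --> X](mul0r `|v|); apply: cvgM; last exact: cvg_cst.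
apply/norm_cvg0P; rewrite -(subrr u).
by apply: cvgB => //; exact: cvg_cst.
Qed.

(** * Minimization over closed convex sets, projections, Riesz representation *)

Lemma convex_segment D u v t : convex_set D -> D u -> D v -> 0 <= t -> t <= 1 ->
  D (u + t *: (v - u)).
Proof.
move=> cD Du Dv t0 t1.
have := cD v u (Itv01 t0 t1); rewrite !inE => /(_ Dv Du).
suff -> : conv (Itv01 t0 t1 : {i01 R}) (v : convex_lmodType H) u =
    u + t *: (v - u) by [].
rewrite /conv/= /unstable.onem scalerBl scale1r scalerBr.
by rewrite addrCA.
Qed.

(* Uniform midpoint convexity makes the filter generated by the sublevel sets
   of q in D a Cauchy filter. *)
Lemma exists_minimizer D (q : H -> R) (b : R) :
  D !=set0 -> closed D -> convex_set D ->
  (forall u, D u -> b <= q u) -> continuous q ->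
  (forall u v, q (u + 2^-1 *: (v - u)) <=
               (q u + q v) / 2 - `|u - v| ^+ 2 / 4) ->
  exists2 p, D p & forall z, D z -> q p <= q z.
Proof.
move=> [a Da] clD cD bq cq mid.
have hi : has_inf (q @` D).
  by split; [exists (q a), a | exists b => _ [z Dz <-]; exact: bq].
pose i := inf (q @` D).
have iq z : D z -> i <= q z by move=> Dz; apply: ge_inf; [case: hi | exists z].
pose S e := D `&` [set z | q z < i + e].
have S0 e : 0 < e -> S e !=set0.
  by move=> e0; have [_ [z Dz <-] qz] := inf_adherent e0 hi; exists z; split.
have FF : Filter (filter_from [set e : R | 0 < e] S).
  apply: filter_from_filter; first by exists 1; rewrite /= ltr01.
  move=> e1 e2 /= e10 e20; exists (Num.min e1 e2).
    by rewrite /= lt_min e10.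
  move=> z [Dz /= qz]; have [h1 h2] : q z < i + e1 /\ q z < i + e2.
    by split; apply: (lt_le_trans qz); rewrite lerD2l ge_min lexx// orbT.
  by split; split.
have PF : ProperFilter (filter_from [set e : R | 0 < e] S).
  by apply: filter_from_proper => e /S0.
have /cvg_ex[p Fp] : cvg (filter_from [set e : R | 0 < e] S).
  apply/cauchy_cvgP/cauchy_exP => e e0.
  (* For z, w in [S (e ^+ 2 / 4)] the midpoint has value at least i, so [mid] gives |z - w|^2 / 4 <=
     (q z + q w) / 2 - i < e^2 / 4. *)
  have d0 : 0 < e ^+ 2 / 4 by rewrite divr_gt0 ?exprn_gt0.
  have [z [Dz qz]] := S0 _ d0; exists z, (e ^+ 2 / 4) => // w [Dw qw].
  rewrite -ball_normE /ball_/= -ltr_sqr ?nnegrE ?(ltW e0)//.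
  have := mid z w.
  have Dm : D (z + 2^-1 *: (w - z)) by apply: convex_segment => //; lra.
  by move: (iq _ Dm) qz qw; rewrite /=; lra.
have Dp : D p.
  apply: (@closed_cvg _ _ _ PF id D clD _ p).
    by exists 1 => [|z []]; rewrite /= ?ltr01.
  exact: Fp.
exists p => // z Dz; apply: le_trans (iq _ Dz).
apply/ler_addgt0Pr => e e0.
have qF : q x @[x --> filter_from [set e : R | 0 < e] S] --> q p.
  exact: cvg_comp Fp (cq p).
apply: (ler_cvg_to qF (cvg_cst _)).
by exists e => // w [_ /ltW].
Qed.
(** The parallelogram law, in the form of the midpoint hypothesis of [exists_minimizer]. *)
Lemma dist_sq_midpoint u v w :
  `|w - (u + 2^-1 *: (v - u))| ^+ 2 =
  (`|w - u| ^+ 2 + `|w - v| ^+ 2) / 2 - `|u - v| ^+ 2 / 4.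
Proof.
rewrite !hdot !dotE (dotC v u) (dotC u w) (dotC v w); lra.
Qed.

Lemma metric_projP D u : D !=set0 -> closed D -> convex_set D ->
  is_nearest D u (metric_proj D u).
Proof.
move=> D0 clD cD; apply: xgetPex.
have [||v w|p Dp pmin] := 
  @exists_minimizer D (fun z => `|u - z| ^+ 2) 0 D0 clD cD.
- by move=> z _; exact: exprn_ge0.
- move=> z; have cn : `|u - w| @[w --> z] --> `|u - z|.
    by apply: cvg_norm; apply: cvgB; [exact: cvg_cst | exact: cvg_id].
  exact: (cvgM cn cn).
- by rewrite dist_sq_midpoint.
by exists p; split=> // z /pmin; rewrite ler_sqr ?nnegrE.
Qed.

(** Comparing p with the point p + t (z - p) of D and expanding gives 2 t <u - p, z - p> <= t^2 |z -
    p|^2. *)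
Lemma nearest_obtuse D u p z : convex_set D -> is_nearest D u p -> D z ->
  dot (u - p) (z - p) <= 0.
Proof.
move=> cD [Dp pmin] Dz.
suff : 2 * dot (u - p) (z - p) <= 0 by lra.
apply: (@le0_of_le_scale _ _ (`|z - p| ^+ 2)) => t t0 t1.
have := pmin _ (convex_segment cD Dp Dz (ltW t0) t1).
rewrite -ler_sqr ?nnegrE// opprD addrA !hdot.
move: (u - p) (z - p) => a b; rewrite !dotE (dotC b a) => h.
by rewrite -(ler_pM2l t0); lra.
Qed.

(* Minimizing |v|^2 - 2 phi v avoids orthogonal complements. *)
Lemma riesz_representation (phi : H -> R) (M : R) :
  scalar phi -> (forall v, `|phi v| <= M * `|v|) ->
  exists u, forall v, phi v = dot u v.
Proof.
move=> lphi bphi.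
have phiB v w : phi w - phi v = phi (w - v).
  by have := lphi (- 1) v w; rewrite scaleN1r mulN1r addrC => <-; rewrite addrC.
have phi_seg u v t : phi (u + t *: v) = phi u + t * phi v.
  by rewrite addrC lphi addrC.
have phiN v : phi (- v) = - phi v.
  by have := phiB 0 0; have := phiB v 0; rewrite sub0r (subrr (0 : H)); lra.
have cphi : continuous phi.
  move=> v; apply: (@cvg_of_dist_le _ _ _ _ _ (fun w => M * `|w - v|)).
    by apply: nearW => w; rewrite phiB bphi.
  rewrite -[X in _ --> X](mulr0 M); apply: cvgM; first exact: cvg_cst.
  by apply/norm_cvg0P; rewrite -(subrr v); apply: cvgB;
    [exact: cvg_id | exact: cvg_cst].
pose q v := `|v| ^+ 2 - 2 * phi v.
(* The lower bound comes from |v|^2 - 2 phi v >= |v|^2 - 2 M |v| >= - M^2. *)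
have [|||v _|v|v w|u _ umin] := @exists_minimizer setT q (- M ^+ 2).
- by exists 0.
- exact: closedT.
- by move=> *; rewrite inE.
- have := sqr_ge0 (`|v| - M); have := bphi v; rewrite ler_norml => /andP[_].
  by rewrite /q; lra.
- apply: cvgB; first by apply: cvgM; apply: cvg_norm; exact: cvg_id.
  by apply: cvgM; [exact: cvg_cst | exact: cphi].
- by rewrite /q phi_seg -phiB !hdot !dotE (dotC w v); lra.
(* First variation of q at its minimizer u; using it for v and - v yields equality. *)
have half v : phi v - dot u v <= 0.
  suff : 2 * (phi v - dot u v) <= 0 by lra.
  apply: (@le0_of_le_scale _ _ (`|v| ^+ 2)) => t t0 t1.
  have := umin (u + t *: v) I; rewrite /q phi_seg !hdot !dotE (dotC v u).
  by move=> h; rewrite -(ler_pM2l t0); lra.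
exists u => v; apply/eqP; rewrite eq_le -subr_le0 half/= -subr_le0.
by have := half (- v); rewrite phiN dotNr; lra.
Qed.

(** * Weak limits along ultrafilters and the variational inequality *)

Lemma weak_ultrafilter_limit (U : set_system nat) (x : nat -> H) (M : R) :
  UltraFilter U -> (forall n, `|x n| <= M) ->
  exists u, forall v, dot (x n) v @[n --> U] --> dot u v.
Proof.
move=> UU xM.
have cx v : cvg (dot (x n) v @[n --> U]).
  apply: (@ultrafilter_cvg_bounded _ _ _ _ (M * `|v|)) => n.
  by rewrite (le_trans (dot_norm_le _ _))// ler_wpM2r.
have [|v|u uP] :=
  @riesz_representation (fun v => lim (dot (x n) v @[n --> U])) M.
- move=> t v w; apply/cvg_lim => //.
  under eq_fun do rewrite dotDr dotZr.
  by apply: cvgD; [apply: cvgM; [exact: cvg_cst|]|]; exact: cx.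
- rewrite /=.
  have cn : `|dot (x n) v| @[n --> U] --> `|lim (dot (x n) v @[n --> U])|.
    by apply: cvg_norm; exact: cx.
  apply: (ler_cvg_to cn (cvg_cst _)); apply: nearW => n.
  by rewrite (le_trans (dot_norm_le _ _))// ler_wpM2r.
by exists u => v; rewrite -uP; exact: cx.
Qed.

(** For two ultrafilter limits u0 and u in S, |x n - u|^2 - |x n - u0|^2 equals 2 <x n, u0 - u> up
    to a constant. So <x n, u0 - u> converges, its limits along both ultrafilters agree, and |u0 -
    u|^2 = 0. *)
Lemma opial (x : nat -> H) (S : set H) (M : R) :
  (forall n, `|x n| <= M) -> (forall s, S s -> cvgn (fun n => `|x n - s|)) ->
  (forall U u, UltraFilter U -> \oo `<=` U ->
     (forall v, dot (x n) v @[n --> U] --> dot u v) -> S u) ->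
  exists2 u, S u & weakly_cvg dot x u.
Proof.
move=> xM xS xU.
have [U0 [UU0 sU0]] := ultraFilterLemma (eventually_filter : ProperFilter \oo).
have [u0 u0P] := weak_ultrafilter_limit UU0 xM.
exists u0; first exact: xU u0P.
move=> v; apply: cvg_ultrafilterP => U UU sU.
have [u uP] := weak_ultrafilter_limit UU xM.
suff -> : u0 = u by exact: uP.
have cs s : S s -> cvgn (fun n => `|x n - s| ^+ 2).
  by move=> /xS cxs; apply: is_cvgM.
have c : cvgn (fun n => dot (x n) (u0 - u)).
  have -> : (fun n => dot (x n) (u0 - u)) = (fun n => 2^-1 *
      (`|x n - u| ^+ 2 - `|x n - u0| ^+ 2 + (`|u0| ^+ 2 - `|u| ^+ 2))).
    apply/funext => n; rewrite !hdot !dotE (dotC u (x n)) (dotC u0 (x n)).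
    by field.
  apply: is_cvgM; first exact: is_cvg_cst.
  apply: is_cvgD; last exact: is_cvg_cst.
  by apply: is_cvgB; apply: cs; [exact: xU uP|exact: xU u0P].
have /cvg_ex[l cl] := c.
have e0 : dot u0 (u0 - u) = l.
  by apply: (cvg_unique _ (u0P _)) => // A /cl; exact: sU0.
have e1 : dot u (u0 - u) = l.
  by apply: (cvg_unique _ (uP _)) => // A /cl; exact: sU.
apply/eqP; rewrite -subr_eq0 -normr_eq0 -sqrf_eq0 hdot.
by rewrite dotDl dotNl e0 e1 subrr.
Qed.

(** With p the projection of u, the inequality <u - p, y t - p> <= 0 passes to the weak limit and
    becomes |u - p|^2 <= 0. *)
Lemma weak_limit_in_closed_convex (T : topologicalType) (U : set_system T)
    (y : T -> H) D u : ProperFilter U -> closed D -> convex_set D ->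
  (forall t, D (y t)) -> (forall v, dot (y t) v @[t --> U] --> dot u v) -> D u.
Proof.
move=> PU clD cD Dy yu.
have [t0 _] := filter_ex (@filterT _ U _).
have D0 : D !=set0 by exists (y t0).
have pP := metric_projP u D0 clD cD.
set p := metric_proj D u in pP.
suff -> : u = p by case: pP.
apply/eqP; rewrite -subr_eq0 -normr_eq0 -sqrf_eq0 -(rwP eqP); apply/le_anti.
rewrite sqr_ge0 andbT hdot {1}dotDl dotNl subr_le0.
apply: (ler_cvg_to (yu (u - p)) (cvg_cst _)); apply: nearW => t.
by have := nearest_obtuse cD pP (Dy t); rewrite dotC dotDl dotNl subr_le0.
Qed.

(** Testing at u + t (v - u), the Lipschitz bound replaces F there by F u with an error of t L |v -
    u|^2. *)
Lemma minty C F (L : R) u : convex_set C -> lipschitz_const L F -> C u ->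
  (forall v, C v -> 0 <= dot (F v) (v - u)) -> SOL dot C F u.
Proof.
move=> cC lF Cu h; split => // v Cv; rewrite -oppr_le0.
apply: (@le0_of_le_scale _ _ (L * `|v - u| ^+ 2)) => t t0 t1.
have := h _ (convex_segment cC Cu Cv (ltW t0) t1).
rewrite addrAC subrr add0r dotZr pmulr_rge0// => h0.
have := dot_le (F (u + t *: (v - u)) - F u) (v - u).
have := lF (u + t *: (v - u)) u.
rewrite addrAC subrr add0r normrZ gtr0_norm// => h1.
have h2 := ler_wpM2r (normr_ge0 (v - u)) h1.
by rewrite dotDl dotNl; lra.
Qed.

(** Monotonicity gives <F v, x - v> <= <F x, x - y> + <F x, y - v>, and the obtuse angle at y bounds
    the last term. For fixed v and bounded x, the right side vanishes with |x - y| and |e|. *)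
Lemma minty_residual C F (gamma g0 : R) (e x y v : H) :
  convex_set C -> monotone_op dot F -> 0 < g0 -> g0 <= gamma ->
  is_nearest C (x - gamma *: F x + e) y -> C v ->
  dot (F v) (x - v) <=
    g0^-1 * ((`|x - y| + `|e|) * `|v - y|) + `|F x| * `|x - y|.
Proof.
move=> cC mF g00 g0g yP Cv.
have gp : 0 < gamma by exact: lt_le_trans g0g.
have h := nearest_obtuse cC yP Cv.
have h1 : dot (F x) (y - v) <= gamma^-1 * ((`|x - y| + `|e|) * `|v - y|).
  rewrite ler_pdivlMl//.
  have := dot_le (- (x - y)) (v - y); have := dot_le (- e) (v - y).
  move: h; rewrite !normrN !dotE; lra.
have h2 : gamma^-1 * ((`|x - y| + `|e|) * `|v - y|) <=
          g0^-1 * ((`|x - y| + `|e|) * `|v - y|).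
  by apply: ler_wpM2r; rewrite ?mulr_ge0 ?addr_ge0// lef_pV2.
have := mF x v; have := dot_le (F x) (x - y).
by move: h1 h2; rewrite !dotE; lra.
Qed.

Lemma weak_limit_SOL C F (L M g0 : R) (U : set_system nat) (gamma : nat -> R)
    (x y e : nat -> H) u :
  closed C -> convex_set C -> monotone_op dot F ->
  0 < L -> lipschitz_const L F ->
  ProperFilter U -> (forall n, `|x n| <= M) -> 0 < g0 ->
  (forall n, g0 <= gamma n) ->
  (forall n, is_nearest C (x n - gamma n *: F (x n) + e n) (y n)) ->
  `|x n - y n| @[n --> U] --> 0 -> `|e n| @[n --> U] --> 0 ->
  (forall v, dot (x n) v @[n --> U] --> dot u v) -> SOL dot C F u.
Proof.
move=> clC cC mF L0 lF PU xM g00 g0g yP xy0 e0 xu.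
have yu v : dot (y n) v @[n --> U] --> dot u v.
  have -> : (fun n => dot (y n) v) = (fun n => dot (x n) v - dot (x n - y n) v).
    by apply/funext => n; rewrite -dotNl -dotDl subKr.
  rewrite -[X in _ --> X]subr0 -(linear0l dot v).
  by apply: cvgB => //; apply: dot_cvg; apply/norm_cvg0P.
have Cu : C u.
  by apply: weak_limit_in_closed_convex yu => // n; have [] := yP n.
apply: (minty cC lF Cu) => v Cv.
(* The residual bound made uniform in n through |v - y n| <= |v| + M + |x n - y n| and |F (x n)| <=
   |F v| + L (M + |v|). *)
pose b n := g0^-1 * ((`|x n - y n| + `|e n|) * (`|v| + M + `|x n - y n|)) +
  (`|F v| + L * (M + `|v|)) * `|x n - y n|.
have b0 : b n @[n --> U] --> 0.
  have -> : 0 = g0^-1 * ((0 + 0) * (`|v| + M + 0)) +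
      (`|F v| + L * (M + `|v|)) * 0.
    by rewrite addr0 mul0r !mulr0 addr0.
  apply: cvgD; apply: cvgM; try exact: cvg_cst; last exact: xy0.
  by apply: cvgM; apply: cvgD => //; exact: cvg_cst.
have xv : dot (x n) (F v) - dot v (F v) @[n --> U] -->
     dot u (F v) - dot v (F v).
  by apply: cvgB => //; exact: cvg_cst.
suff : dot u (F v) - dot v (F v) <= 0.
  by rewrite !dotE (dotC (F v) u) (dotC (F v) v); lra.
apply: (ler_cvg_to xv b0); apply: nearW => n.
have := minty_residual cC mF g00 (g0g n) (yP n) Cv.
rewrite -dotNl -dotDl dotC => /le_trans; apply; rewrite /b lerD//.
  rewrite ler_pM2l ?invr_gt0// ler_wpM2l ?addr_ge0//.
  have := ler_normB v (x n); have := ler_normD (v - x n) (x n - y n).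
  by rewrite subrKA; have := xM n; lra.
rewrite ler_wpM2r//.
have := lF (x n) v; have := ler_normD (F (x n) - F v) (F v); rewrite subrK.
have : L * `|x n - v| <= L * (M + `|v|).
  by rewrite ler_pM2l//; have := ler_normB (x n) v; have := xM n; lra.
by lra.
Qed.

(** * One step of the method: half-spaces, descent estimate, step size *)

Lemma halfspaceT_closed (a y : H) : closed (halfspaceT dot a y).
Proof.
have -> : halfspaceT dot a y =
    (fun w => dot (w - y) (a - y)) @^-1` [set r | r <= 0].
  by apply/seteqP; split => w; rewrite /halfspaceT/= dotC.
apply: preimage_closed; last exact: closed_le.
move=> w _; apply: (@dot_cvg _ (nbhs w) _ (fun z => z - y)).
by apply: cvgB; [exact: cvg_id | exact: cvg_cst].
Qed.

Lemma halfspaceT_convex (a y : H) : convex_set (halfspaceT dot a y).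
Proof.
move=> u v t; rewrite !inE /halfspaceT/= => hu hv.
have -> : conv t u v - y = t%:num *: (u - y) + (1 - t%:num) *: (v - y).
  rewrite !scalerBr addrACA -opprD -scalerDl [t%:num + _]addrC subrK scale1r.
  by [].
have [t0 t1] : 0 <= t%:num /\ t%:num <= 1 by [].
rewrite -subr_ge0 in t1; rewrite dotDr !dotZr.
by rewrite -oppr_ge0 opprD addr_ge0// oppr_ge0 mulr_ge0_le0.
Qed.

(** The projection inequality at x' bounds |x' - s|^2 by |x - s|^2 - |x - x'|^2 + 2 gamma <fy, s -
    x'> + 2 <e2, x' - s>. The sign of <fy, y - s> replaces s by y in the third term. Splitting |x -
    x'|^2 at y and using the half-space inequality leaves 2 gamma <fx - fy, x' - y>, controlled by
    the line search, and an e1 term. *)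
Lemma extragradient_step (gamma mu : R) (x y x' s e1 e2 fx fy : H) :
  0 <= gamma -> 0 <= mu ->
  dot (x - gamma *: fx + e1 - y) (x' - y) <= 0 ->
  dot (x - gamma *: fy + e2 - x') (s - x') <= 0 ->
  0 <= dot fy (y - s) -> gamma * `|fx - fy| <= mu * `|x - y| ->
  `|x' - s| ^+ 2 <= `|x - s| ^+ 2 - (1 - mu) * (`|x - y| ^+ 2 + `|x' - y| ^+ 2)
    + 2 * `|e1| * `|x' - y| + 2 * `|e2| * `|x' - s|.
Proof.
move=> g0 mu0 h1 h2 h3 h4.
have h3' := mulr_ge0 g0 h3.
have hA := ler_wpM2l g0 (dot_le (fx - fy) (x' - y)).
have hB := ler_wpM2r (normr_ge0 (x' - y)) h4.
(* the mixed term p r is absorbed by (p^2 + r^2) / 2 *)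
have hM : 0 <= mu * (`|x - y| - `|x' - y|) ^+ 2.
  by rewrite mulr_ge0 ?sqr_ge0.
have hC := dot_le (- e1) (x' - y).
have hD := dot_le e2 (x' - s).
move: hA hB hM hC hD h1 h2 h3'; rewrite normrN.
have := hdot (x - y); have := hdot (x' - y).
move: `|x - y| `|x' - y| => p r.
rewrite !hdot !dotE.
rewrite (dotC y x) (dotC s x) (dotC x' y) (dotC s x').
lra.
Qed.

(** If m = 0 the step is sigma. Otherwise the failed test at m - 1 and the Lipschitz bound force the
    previous step above mu / L, and one more factor rho gives the claim. *)
Lemma linesearch_lower_bound C F (L sigma rho mu : R) (e x : H) (m : nat) :
  0 < L -> lipschitz_const L F -> 0 < sigma -> 0 < rho -> 0 < mu ->
  (forall j, (j < m)%N -> ~ linesearch_ok C F mu (sigma * rho ^+ j) e x) ->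
  Num.min sigma (rho * mu / L) <= sigma * rho ^+ m.
Proof.
move=> L0 lF s0 r0 mu0 fail; rewrite ge_min.
case: m fail => [_|j /(_ j (ltnSn j))]; first by rewrite expr0 mulr1 lexx.
rewrite /linesearch_ok/=; set v := proj_step _ _ _ _ _ => /negP.
rewrite -ltNge => h; apply/orP; right.
have g0 : 0 < sigma * rho ^+ j by rewrite mulr_gt0// exprn_gt0.
have h1 := lt_le_trans h (ler_wpM2l (ltW g0) (lF x v)).
(* The failed test is strict, so the norm is nonzero and can be cancelled. *)
have n0 : 0 < `|x - v|.
  rewrite lt_neqAle normr_ge0 andbT; apply/eqP => n0.
  by move: h1; rewrite -n0 !mulr0 ltxx.
move: h1; rewrite mulrA ltr_pM2r// => h1.
rewrite ler_pdivrMr// exprS mulrCA -mulrA ler_pM2l//.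
exact: ltW.
Qed.

End RealHilbert.

(** * Distances to solutions, vanishing residuals and weak convergence *)

Theorem theorem5p5 (R : realType) (H : completeNormedModType R)
    (dot : {dot H for idfun}) (hdot : norm_of_dot dot)
    (C : set H) (C_nonempty : C !=set0) (C_closed : closed C)
    (C_convex : convex_set C)
    (F : H -> H) (SOL_nonempty : SOL dot C F !=set0)
    (F_monotone : monotone_op dot F)
    (L : R) (L_gt0 : 0 < L) (F_lipschitz : lipschitz_const L F)
    (sigma rho mu : R) (sigma_gt0 : 0 < sigma)
    (rho_gt0 : 0 < rho) (rho_lt1 : rho < 1) (mu_gt0 : 0 < mu) (mu_lt1 : mu < 1)
    (e1 e2 : nat -> H -> H) (x y : nat -> H) (m : nat -> nat)
    (e1_summable : cvgn (series (fun k => `|e1 k (x k)|)))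
    (e2_summable : cvgn (series (fun k => `|e2 k (x k)|)))
    (method : perturbed_subgradient_extragradient
                dot C F sigma rho mu e1 e2 x y m) :
  exists2 u : H, SOL dot C F u & weakly_cvg dot x u.
Proof.
pose g k := sigma * rho ^+ m k.
pose a k := `|e1 k (x k)|.
pose b k := `|e2 k (x k)|.
have g_gt0 k : 0 < g k by rewrite mulr_gt0// exprn_gt0.
have yP k : is_nearest C (x k - g k *: F (x k) + e1 k (x k)) (y k).
  by have [_ _ -> _ _] := method k; exact: (metric_projP hdot).
have step k s : SOL dot C F s ->
    `|x k.+1 - s| ^+ 2 <= `|x k - s| ^+ 2 -
      (1 - mu) * (`|x k - y k| ^+ 2 + `|x k.+1 - y k| ^+ 2)
      + 2 * a k * `|x k.+1 - y k| + 2 * b k * `|x k.+1 - s|.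
  move=> [Cs hs]; have [ls _ yE _ xE] := method k.
  have Cy : C (y k) by have [] := yP k.
  set T := halfspaceT dot _ _ in xE.
  have cT : convex_set T by exact: halfspaceT_convex.
  have xP : is_nearest T (x k - g k *: F (y k) + e2 k (x k)) (x k.+1).
    rewrite xE; apply: (metric_projP hdot) => //; last exact: halfspaceT_closed.
    by exists (y k); rewrite /T /halfspaceT/= subrr linear0r.
  apply: (extragradient_step hdot (gamma := g k) (fx := F (x k))
    (fy := F (y k))).
  - exact: ltW.
  - exact: ltW.
  - by have [] := xP.
  (* The solution s lies in T because the obtuse angle at [y k] puts all of C in this half-space. *)
  - by apply: (nearest_obtuse hdot cT xP);
      exact: (nearest_obtuse hdot C_convex (yP k)).
  - have := F_monotone (y k) s; have := hs _ Cy.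
    by rewrite !dotE; lra.
  - by move: ls; rewrite /linesearch_ok/= -yE.
have a0 k : 0 <= a k by exact: normr_ge0.
have b0 k : 0 <= b k by exact: normr_ge0.
have k0 : 0 < 1 - mu by rewrite subr_gt0.
have k1 : 1 <= (1 - mu)^-1 by rewrite invf_ge1// gerBl ltW.
have bound k s (Ss : SOL dot C F s) :=
  quasi_fejer_bound mu_lt1 (step k s Ss).
have dist_cvg s : SOL dot C F s -> cvgn (fun k => `|x k - s|).
  move=> Ss.
  apply: (@cvg_of_le_add_summable _ _
    (fun k => (1 - mu)^-1 * a k + 2 * b k)) => //.
    have -> : series (fun k => (1 - mu)^-1 * a k + 2 * b k) =
        (fun n => (1 - mu)^-1 * series a n + 2 * series b n).
      by apply/funext => n; rewrite /series/= big_split/= !mulr_sumr.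
    by apply: is_cvgD; apply: is_cvgM => //; exact: is_cvg_cst.
  move=> n; apply: le_add_of_sq_le => //; have := bound n s Ss.
  by have := mulr_ge0 (ltW k0) (sqr_ge0 (`|x n - y n|)); lra.
have [s Ss] := SOL_nonempty.
have /cvg_ex[d dP] := dist_cvg s Ss.
have aP : a k @[k --> \oo] --> 0 by exact: cvg_series_cvg_0.
have bP : b k @[k --> \oo] --> 0 by exact: cvg_series_cvg_0.
have xy0 : `|x k - y k| @[k --> \oo] --> 0.
  (* [bound] solved for |x k - y k|^2; c tends to 0 because consecutive squared distances to s share
     the limit d^2. *)
  pose c k := (1 - mu)^-1 * (`|x k - s| ^+ 2 - `|x k.+1 - s| ^+ 2 +
    (1 - mu)^-1 * a k ^+ 2 + 2 * b k * `|x k.+1 - s|).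
  have dSP : `|x k.+1 - s| @[k --> \oo] --> d.
    by rewrite (cvg_shiftS (fun k => `|x k - s|)).
  have c0 : c k @[k --> \oo] --> 0.
    have -> : 0 = (1 - mu)^-1 *
        (d ^+ 2 - d ^+ 2 + (1 - mu)^-1 * 0 ^+ 2 + 2 * 0 * d).
      by ring.
    apply: cvgM; first exact: cvg_cst.
    apply: cvgD; last by apply: cvgM dSP; apply: cvgM bP; exact: cvg_cst.
    apply: cvgD; last by apply: cvgM; [exact: cvg_cst | exact: (cvgM aP aP)].
    by apply: cvgB; [exact: (cvgM dP dP) | exact: (cvgM dSP dSP)].
  have p0 : `|x k - y k| ^+ 2 @[k --> \oo] --> 0.
    apply: (squeeze_cvgr _ (cvg_cst 0) c0); apply: nearW => k.
    by rewrite sqr_ge0/= /c ler_pdivlMl// bound.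
  have -> : (fun k => `|x k - y k|) = (fun k => Num.sqrt (`|x k - y k| ^+ 2)).
    by apply/funext => k; rewrite sqrtr_sqr normr_id.
  rewrite -[X in _ --> X]sqrtr0; apply: cvg_comp p0 _; exact: sqrt_continuous.
have [M [_ /(_ (M + 1))]] := cvg_seq_bounded (dist_cvg s Ss).
rewrite ltrDl ltr01 => /(_ isT) Mb.
have xM n : `|x n| <= M + 1 + `|s|.
  have := ler_normD (x n - s) s; rewrite subrK => /le_trans; apply.
  by rewrite lerD2r; have := Mb n I; rewrite /= normr_id.
apply: (opial hdot xM dist_cvg) => U u UU sU xu.
apply: (@weak_limit_SOL _ _ _ hdot C F L _
  (Num.min sigma (rho * mu / L)) U g x y (fun k => e1 k (x k)) u) => //.
- by rewrite lt_min sigma_gt0 divr_gt0 ?mulr_gt0.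
- move=> k; have [_ fail _ _ _] := method k.
  exact: (linesearch_lower_bound L_gt0 F_lipschitz _ _ _ fail).
- by move=> A /xy0; exact: sU.
- by move=> A /aP; exact: sU.
Qed.
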